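(* For every fixed $\varepsilon>0$, there is a constant $c_\varepsilon>0$ such that $$\pi(H_3^r)\ge \frac{c_\varepsilon}{r(\log r)^{2+\varepsilon}}$$ for all sufficiently large integers $r$. Hence $\pi(H_3^r)=r^{-1+o(1)}$ as $r\to\infty$.
   Context: An $r$-graph is an $r$-uniform hypergraph. For $r\ge 2$ and $3\le k\le r+1$, $H_k^r$ denotes the $r$-graph on $r+1$ vertices with exactly $k$ edges (unique up to isomorphism, since each $r$-subset of an $(r+1)$-set omits exactly one vertex). An $r$-graph $G$ is $H$-free if it contains no copy of $H$ as a (not necessarily induced) subgraph. $\mathrm{ex}(n,H)$ is the maximum number of edges in an $H$-free $r$-graph on $n$ vertices, and the Turán density is $\pi(H)=\lim_{n\to\infty}\mathrm{ex}(n,H)/\binom{n}{r}$. $\log$ denotes the natural logarithm. The statement $\pi(H_3^r)=r^{-1+o(1)}$ means $\log \pi(H_3^r)/\log r\to -1$ as $r\to\infty$. *)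

(* Defs.v *)
From HB Require Import structures.
From mathcomp Require Import all_boot all_order all_algebra.
From mathcomp Require Import all_classical all_reals all_analysis.
Import Order.TTheory GRing.Theory Num.Theory.
Import numFieldNormedType.Exports.

Set Implicit Arguments.
Unset Strict Implicit.
Unset Printing Implicit Defensive.

(** A hypergraph on a finite vertex type is represented by its set of edges. *)

Definition uniform (r : nat) (V : finType) (G : {set {set V}}) : bool :=
  [forall e in G, #|e| == r].

(** A copy is an injection of the vertices mapping edges to edges; it need not
    be induced. *)
Definition has_copy (W V : finType) (H : {set {set W}}) (G : {set {set V}})
    : bool :=
  [exists f : {ffun W -> V}, injectiveb f && [forall e in H, (f @: e) \in G]].

Definition copy_free (W V : finType) (H : {set {set W}}) (G : {set {set V}})
    : bool :=
  ~~ has_copy H G.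

Definition turan_number (r n : nat) (W : finType) (H : {set {set W}}) : nat :=
  \max_(G : {set {set 'I_n}} | uniform r G && copy_free H G) #|G|.

Definition turan_density (R : realType) (r : nat) (W : finType)
    (H : {set {set W}}) : R :=
  limn (fun n : nat => (turan_number r n H)%:R / 'C(n, r)%:R : R)%R.

(** [Hgraph r k] is $H_k^r$: its edges are the complements of the first [k]
    vertices. *)
Definition Hgraph (r k : nat) : {set {set 'I_r.+1}} :=
  [set [set~ i] | i : 'I_r.+1 & i < k].

Lemma uniform_Hgraph r k : uniform r (Hgraph r k).
Proof.
apply/forall_inP => e /imsetP[i _ ->].
by rewrite cardsC1 card_ord.
Qed.

Lemma setC1_inj (T : finType) : injective (fun x : T => [set~ x]).
Proof. by move=> x y /(can_inj (@finset.setCK T)) /finset.set1_inj. Qed.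

Lemma card_Hgraph r k : k <= r.+1 -> #|Hgraph r k| = k.
Proof.
move=> kr; rewrite card_imset; last exact: setC1_inj.
transitivity #|[set widen_ord kr j | j : 'I_k]|; last first.
  by rewrite card_imset ?card_ord // => x y /(congr1 val) /= xy; exact: val_inj.
apply: eq_card => i; rewrite inE; apply/idP/imsetP => [ik|[j _ ->]] /=.
  by exists (Ordinal ik) => //; apply: val_inj.
exact: ltn_ord j.
Qed.

(* Main.v *)
Require Import Defs.
From HB Require Import structures.
From mathcomp Require Import all_boot all_order all_algebra.
From mathcomp Require Import all_classical all_reals all_analysis.
From mathcomp Require Import fingroup perm ring lra zify.
From mathcomp Require Import fintype finset.
Import Order.TTheory GRing.Theory Num.Theory.
Import numFieldNormedType.Exports.

Set Implicit Arguments.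
Unset Strict Implicit.
Unset Printing Implicit Defensive.

(** Three edges inside [r.+1] vertices are [T :\ x], [T :\ y], [T :\ z] for a
    common [T].  So a family avoids [Hgraph r 3] exactly when no set [T] loses
    three different points to three members of the family ([triple_free]); this
    form makes sense for families with members of several sizes.

    Upper bound.  A complete [r.+1]-set contains at most two edges, and averaging
    over deleted vertices makes [turan_ratio] nonincreasing.  Hence the density
    exists and is at most [2 / r].

    Lower bound.  The idea is that of a deletion code: an edge has to carry enough
    checksum information to recover, from [T] and from the fact that [T :\ x] is
    an edge, the point [x] up to two possibilities.  Hash the vertices into [m]
    bins, with [m] about [2 * r], and prescribe the sum of the bin numbers modulo
    [m].  This reveals the bin of [x] at the cost of a factor [m] in the density.
    A random edge meets every bin in at most [J = O(log r)] points, so inside the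
    bin of [x] the same problem is left for sets of size at most [J].  Suppose
    that triple-free families of density [1 / K] are known for those sizes.  Then
    [L = O(K log r)] random copies of such a family include, with high
    probability, the trace of the edge on every bin; colour each trace by a copy
    that includes it.  Prescribing the sum of the colours modulo [L] reveals the
    colour of the trace of [T :\ x] on the special bin, and one copy contains at
    most two such traces.  Altogether a triple-free family of density of order
    [1 / (m L)], that is [1 / (r K log r)], is obtained: this is
    [turan_number_recursion] and [turan_bound_step].

    The case [J = 1], [m = 2 * r ^ 2] needs no input and gives density
    [1 / (4 r^2)].  Feeding this into the recursion gives density of order
    [1 / (r (log r)^3)].  Using that bound for the sizes [j <= J = O(log r)] and
    applying the recursion once more gives density of order
    [1 / (r (log r)^2 (log log r)^3)] ([turan_bound]), which is more than
    the theorem asks for. *)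

(** * Triple-free families *)

Definition triple_free (V : finType) (F : {set {set V}}) : Prop :=
  forall (T : {set V}) (x y z : V), x \in T -> y \in T -> z \in T ->
    x != y -> x != z -> y != z ->
    T :\ x \in F -> T :\ y \in F -> T :\ z \in F -> False.

Lemma triple_freeS (V : finType) (F G : {set {set V}}) :
  F \subset G -> triple_free G -> triple_free F.
Proof.
move=> /subsetP FG Gfree T x y z xT yT zT xy xz yz Tx Ty Tz.
by apply: (Gfree T x y z) => //; exact: FG.
Qed.

Lemma imsetD1_inj (W V : finType) (f : W -> V) (A : {set W}) (w : W) :
  injective f -> f @: (A :\ w) = (f @: A) :\ f w.
Proof.
move=> f_inj; apply/setP => v; rewrite !inE.
apply/imsetP/andP => [[t]|[vw /imsetP[t tA vt]]].
  by rewrite !inE => /andP[tw tA] ->; rewrite (inj_eq f_inj) imset_f.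
by exists t => //; rewrite !inE tA andbT; apply: contra_neq vw => <-.
Qed.

Lemma imset_setC1 (W V : finType) (f : W -> V) (i : W) :
  injective f -> f @: [set~ i] = (f @: [set: W]) :\ f i.
Proof. by move=> f_inj; rewrite -setTD imsetD1_inj. Qed.

Lemma triple_free_copy_free r (V : finType) (G : {set {set V}}) :
  1 < r -> triple_free G -> copy_free (Hgraph r 3) G.
Proof.
case: r => [|[|r]] // _ Gfree; apply/existsP => -[f /andP[/injectiveP f_inj]].
move=> /forall_inP fG.
have edge (i : 'I_r.+3) : i < 3 -> (f @: [set: 'I_r.+3]) :\ f i \in G.
  by move=> i3; rewrite -imset_setC1 //; apply/fG/imsetP; exists i; rewrite ?inE.
pose o1 : 'I_r.+3 := lift ord0 ord0; pose o2 : 'I_r.+3 := lift ord0 (lift ord0 ord0).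
apply: (Gfree (f @: [set: 'I_r.+3]) (f ord0) (f o1) (f o2));
  rewrite ?(inj_eq f_inj) ?imset_f //; exact: edge.
Qed.

(** Listing [T] with [x], [y], [z] in front is an embedding of the vertices
    [0, ..., r] that sends the edges of [Hgraph r 3] to the three given sets. *)
Lemma copy_free_triple_free r (V : finType) (G : {set {set V}}) :
  uniform r G -> copy_free (Hgraph r 3) G -> triple_free G.
Proof.
move=> /forall_inP Gr /existsP Gfree T x y z xT yT zT xy xz yz Tx Ty Tz.
apply: Gfree; pose s := x :: y :: z :: enum (T :\ x :\ y :\ z).
have mem_s v : (v \in s) = (v \in T).
  rewrite !inE mem_enum !inE.
  by case: eqVneq => [->|_] //=; case: eqVneq => [->|_] //=; case: eqVneq => [->|].
have s_uniq : uniq s.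
  by rewrite /= !inE !mem_enum !inE !eqxx !negb_or xy xz yz !andbF enum_uniq.
have size_s : size s = r.+1.
  rewrite -(eqP (Gr _ Tx)) -(card_uniqP s_uniq) (eq_card mem_s).
  by rewrite (cardsD1 x T) xT.
exists [ffun i : 'I_r.+1 => nth x s i].
have f_inj : injective [ffun i : 'I_r.+1 => nth x s i].
  move=> i j; rewrite !ffunE => /eqP; rewrite nth_uniq ?size_s //.
  by move/eqP/val_inj.
have imT : [ffun i : 'I_r.+1 => nth x s i] @: setT = T.
  apply/setP => v; rewrite -mem_s; apply/imsetP/idP => [[i _ ->]|vs].
    by rewrite ffunE mem_nth ?size_s.
  have vr : index v s < r.+1 by rewrite -size_s index_mem.
  by exists (Ordinal vr); rewrite ?ffunE ?nth_index.
apply/andP; split; first exact/injectiveP.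
apply/forall_inP => e /imsetP[i i3 ->]; rewrite imset_setC1 // imT ffunE.
by move: i3; rewrite inE; case: i => -[|[|[|i]]].
Qed.

Lemma turan_number_triple_free r n (G : {set {set 'I_n}}) :
  1 < r -> uniform r G -> triple_free G -> #|G| <= turan_number r n (Hgraph r 3).
Proof.
move=> r1 Gr Gfree; apply: leq_bigmax_cond.
by rewrite Gr triple_free_copy_free.
Qed.

(** Some edge is needed in [H], since a graph without edges embeds into every
    graph with enough vertices, and then the maximum ranges over nothing. *)
Lemma turan_numberP r n (W : finType) (H : {set {set W}}) :
  H != set0 -> exists2 G : {set {set 'I_n}},
    uniform r G && copy_free H G & turan_number r n H = #|G|.
Proof.
move=> /set0Pn[e eH].
have P0 : uniform r (set0 : {set {set 'I_n}}) && copy_free H (set0 : {set {set 'I_n}}).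
  apply/andP; split; first by apply/forall_inP => A; rewrite inE.
  apply/existsP => -[f /andP[_ /forall_inP /(_ e eH)]].
  by rewrite inE.
rewrite /turan_number.
rewrite (bigop.bigmax_eq_arg (P := fun G => uniform r G && copy_free H G) set0 P0).
by case: arg_maxnP => // G; exists G.
Qed.

(** * Existence of the density and the upper bound *)

Lemma copy_free_preimset (W V V' : finType) (H : {set {set W}})
    (G : {set {set V}}) (g : V' -> V) :
  injective g -> copy_free H G -> copy_free H [set A : {set V'} | g @: A \in G].
Proof.
move=> g_inj /existsP Gfree; apply/existsP => -[f /andP[/injectiveP f_inj /forall_inP fH]].
apply: Gfree; exists [ffun w => g (f w)]; apply/andP; split.
  by apply/injectiveP => x y; rewrite !ffunE => /g_inj/f_inj.
apply/forall_inP => e /fH; rewrite inE -imset_comp.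
by congr (_ \in G); apply: eq_imset => w /=; rewrite ffunE.
Qed.

(** Delete each vertex in turn from an extremal graph on [n.+1] vertices: every
    edge survives in the [n.+1 - r] subgraphs obtained from vertices outside it. *)
Lemma turan_numberS_le r n (W : finType) (H : {set {set W}}) : H != set0 ->
  (n.+1 - r) * turan_number r n.+1 H <= n.+1 * turan_number r n H.
Proof.
move=> H0; have [G /andP[Gr Gfree] ->] := turan_numberP r n.+1 H0.
pose Gi (i : 'I_n.+1) := [set A : {set 'I_n} | lift i @: A \in G].
have Gi_card i : #|Gi i| = \sum_(e in G) (i \notin e).
  rewrite -(card_imset _ (imset_inj (@lift_inj _ i))) -sum1_card.
  rewrite [RHS]big_mkcond [LHS]big_mkcond /=; apply: eq_bigr => e _.
  have [eG|eG] := boolP (e \in G); last first.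
    by case: ifP => // /imsetP[A]; rewrite inE => AG eA; rewrite eA AG in eG.
  have [ie|ie] := boolP (i \in e) => /=.
    case: ifP => // /imsetP[A _ eA]; move: ie; rewrite eA => /imsetP[j _ ij].
    by have := neq_lift i j; rewrite -ij eqxx.
  have liftK : lift i @: [set j | lift i j \in e] = e.
    apply/setP => j; apply/imsetP/idP => [[k]|je]; first by rewrite inE => ? ->.
    have [k jk|ji] := unliftP i j; last by rewrite -ji je in ie.
    by exists k; rewrite // inE -jk.
  by rewrite -{1}liftK imset_f // inE liftK.
have sum_Gi : \sum_i #|Gi i| = (n.+1 - r) * #|G|.
  under eq_bigr do rewrite Gi_card.
  rewrite exchange_big /= mulnC -sum_nat_const; apply: eq_bigr => e eG.
  rewrite -big_mkcond /= sum1_card -(eqP (forall_inP Gr e eG)).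
  transitivity #|~: e|; first by apply: eq_card => j; rewrite !inE.
  by rewrite cardsCs setCK card_ord.
rewrite -sum_Gi -[n.+1 in X in _ <= X]card_ord -sum_nat_const.
apply: leq_sum => i _; apply: leq_bigmax_cond; apply/andP; split.
  apply/forall_inP => A; rewrite inE => /(forall_inP Gr).
  by rewrite card_imset //; exact: lift_inj.
by apply: copy_free_preimset => //; exact: lift_inj.
Qed.

Lemma turan_number_r1 r : turan_number r r.+1 (Hgraph r 3) <= 2.
Proof.
apply/bigmax_leqP => G /andP[Gr Gfree].
have Gtf := copy_free_triple_free Gr Gfree.
pose X := [set x | [set~ x] \in G].
have GX : G = [set [set~ x] | x in X].
  apply/setP => e; apply/idP/imsetP => [eG|[x]]; last by rewrite inE => xG ->.
  have : #|~: e| == 1.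
    by rewrite cardsCs setCK card_ord (eqP (forall_inP Gr e eG)) subSnn.
  move=> /cards1P[x ex]; exists x; last by rewrite -ex setCK.
  by rewrite inE -ex setCK.
rewrite GX card_imset; last exact: setC1_inj.
rewrite leqNgt; apply/negP => /card_gt2P[x [y [z [[xX yX zX] [xy yz zx]]]]].
have TD v : [set: 'I_r.+1] :\ v = [set~ v] by apply/setP => w; rewrite !inE andbT.
apply: (Gtf setT x y z); rewrite ?TD ?inE // 1?eq_sym //.
- by move: xX; rewrite inE.
- by move: yX; rewrite inE.
- by move: zX; rewrite inE.
Qed.

Section TuranRatio.
Local Open Scope ring_scope.
Local Open Scope classical_set_scope.
Variables (R : realType) (r : nat) (W : finType) (H : {set {set W}}).
Hypothesis H0 : H != finset.set0.

Definition turan_ratio (n : nat) : R :=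
  (turan_number r n H)%:R / 'C(n, r)%:R.

Lemma turan_ratio_nonincreasing (n p : nat) : (r <= n)%N -> (n <= p)%N ->
  turan_ratio p <= turan_ratio n.
Proof.
move=> rn; elim: p => [|p IHp]; first by rewrite leqn0 => /eqP ->.
rewrite leq_eqVlt => /predU1P[-> //|]; rewrite ltnS => np.
apply: le_trans (IHp np); rewrite /turan_ratio.
have rp : (r <= p)%N by exact: leq_trans np.
rewrite ler_pdivrMr ?ltr0n ?bin_gt0 ?leqW // mulrAC ler_pdivlMr ?ltr0n ?bin_gt0 //.
rewrite -!natrM ler_nat.
have pr : (0 < p.+1 - r)%N by rewrite subn_gt0 ltnS.
rewrite -(leq_pmul2l pr) !mulnA [((p.+1 - r) * _ * 'C(p.+1, r))%N]mulnAC.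
rewrite -mul_bin_down [(p.+1 * _ * _)%N]mulnAC leq_mul2r turan_numberS_le //.
by rewrite orbT.
Qed.

Lemma turan_ratio_cvg : cvgn turan_ratio.
Proof.
apply: (near_nonincreasing_is_cvgn (m := 0)).
  exists r => // n /= rn p np; exact: turan_ratio_nonincreasing.
by apply: nearW => n; rewrite /turan_ratio divr_ge0.
Qed.

Lemma turan_density_le (n : nat) : (r <= n)%N ->
  turan_density R r H <= turan_ratio n.
Proof.
move=> rn; apply: limr_le; first exact: turan_ratio_cvg.
by exists n => // p /=; exact: turan_ratio_nonincreasing.
Qed.

Lemma turan_density_ge (a : R) :
  (forall n, (r <= n)%N -> a <= turan_ratio n) -> a <= turan_density R r H.
Proof.
move=> aP; apply: limr_ge; first exact: turan_ratio_cvg.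
by exists r.
Qed.

End TuranRatio.

(** * Gluing local families by checksums *)

Lemma exists_large_fiber (T U : finType) (h : T -> U) (u0 : U) (E : {set T}) :
  exists u, #|E| <= #|U| * #|[set e in E | h e == u]|.
Proof.
pose F u := #|[set e in E | h e == u]|.
exists [arg max_(u > u0) F u]; case: arg_maxnP => // u _ uP.
rewrite -sum_nat_const.
suff -> : #|E| = \sum_v F v by apply: leq_sum => v _; exact: uP.
rewrite -sum1_card (partition_big h xpredT) //=; apply: eq_bigr => v _.
by rewrite sum1_card; apply: eq_card => e; rewrite !inE.
Qed.

Definition bin (V Z : finType) (f : V -> Z) (b : Z) (e : {set V}) : {set V} :=
  [set x in e | f x == b].

Section Gluing.
Variables (V : finType) (Z C : finZmodType) (f : V -> Z).
Variable col : {set V} -> option C.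

Definition coloured (e : {set V}) : bool := [forall b, col (bin f b e)].

(** The two checksums of the construction.  The default [0] only matters for
    sets that are not [coloured]. *)
Definition hash (e : {set V}) : Z * C :=
  (\sum_(x in e) f x, \sum_b odflt 0 (col (bin f b e)))%R.

(** If [T :\ x], [T :\ y], [T :\ z] have the same hash, the first checksum puts
    [x], [y], [z] into one bin [b].  The traces on the other bins are those of
    [T], so the second checksum makes the three traces on [b] equally coloured,
    and the claim descends to the trace of [T] on [b]. *)
Lemma triple_free_hash (u : Z * C) :
  (forall i, triple_free [set A | col A == Some i]) ->
  triple_free [set e | coloured e & hash e == u].
Proof.
move=> col_free T x y z xT yT zT xy xz yz.
rewrite !inE => /andP[/forallP cx /eqP hx] /andP[/forallP cy /eqP hy] /andP[/forallP cz /eqP hz].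
have fE w : w \in T -> hash (T :\ w) = u -> (f w = \sum_(v in T) f v - u.1)%R.
  by move=> wT <-; rewrite (big_setD1 w wT) /= addrK.
pose b := f x.
have fy : f y = b by rewrite /b !fE.
have fz : f z = b by rewrite /b !fE.
have binE w c : f w = b -> bin f c (T :\ w) = if c == b then bin f b T :\ w else bin f c T.
  move=> fw; apply/setP => v; case: eqVneq => [->|cb]; rewrite !inE ?andbA //.
  by case: (eqVneq v w) => [->|//]; rewrite fw [b == c]eq_sym (negPf cb) !andbF.
pose rest := (\sum_(c | c != b) odflt 0 (col (bin f c T)))%R.
have colE w : f w = b -> (forall c, col (bin f c (T :\ w))) -> hash (T :\ w) = u ->
    col (bin f b T :\ w) = Some (u.2 - rest)%R.
  move=> fw /(_ b); rewrite binE // eqxx => cw <- /=.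
  rewrite (bigD1 b) //= binE // eqxx.
  under eq_bigr => c cb do rewrite binE // (negPf cb).
  by rewrite addrK; case: (col _) cw.
apply: (col_free (u.2 - rest)%R (bin f b T) x y z) => //;
  by rewrite inE; first [rewrite colE | rewrite ?xT ?yT ?zT ?fy ?fz ?eqxx].
Qed.

End Gluing.

Lemma triple_free_preimset (V : finType) (F : {set {set V}}) (s : V -> V) :
  injective s -> triple_free F -> triple_free [set A : {set V} | s @: A \in F].
Proof.
move=> s_inj F_free T x y z xT yT zT xy xz yz; rewrite !inE.
by rewrite !imsetD1_inj //; apply: F_free; rewrite ?(inj_eq s_inj) ?imset_f.
Qed.

(** * Counting permutations and hash functions *)

Lemma exists_perm_imset (V : finType) (A B : {set V}) :
  #|A| = #|B| -> exists s : {perm V}, s @: A = B.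
Proof.
move=> AB; pose es (X : {set V}) := enum X ++ enum (~: X).
have mem_es X v : v \in es X by rewrite mem_cat !mem_enum inE orbN.
have es_uniq X : uniq (es X).
  rewrite cat_uniq !enum_uniq andbT /=; apply/hasPn => v.
  by rewrite !mem_enum inE.
have size_es X : size (es X) = #|V|.
  by rewrite -(card_uniqP (es_uniq X)); apply: eq_card => v; rewrite mem_es.
have s_inj : injective (fun v => nth v (es B) (index v (es A))).
  move=> v w; rewrite (set_nth_default w v) ?size_es -?(size_es A) ?index_mem //.
  move/eqP; rewrite nth_uniq // ?size_es -?(size_es A) ?index_mem //.
  by move=> /eqP /(congr1 (nth v (es A))); rewrite !nth_index.
exists (perm s_inj); apply/eqP; rewrite eqEcard card_imset ?AB ?leqnn ?andbT; last exact: perm_inj.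
apply/subsetP => _ /imsetP[v vA ->]; rewrite permE.
have iA : index v (es A) < #|B|.
  by rewrite -AB index_cat mem_enum vA cardE index_mem mem_enum.
by rewrite nth_cat -cardE iA -mem_enum mem_nth // -cardE.
Qed.

(** The image of [A] under a uniformly random permutation is uniform among the
    sets of size [#|A|], by transitivity: the number [N B] of permutations that
    send [A] to [B] is the same for all such [B]. *)
Lemma card_perm_imset_in (V : finType) (A : {set V}) (F : {set {set V}}) :
  #|[set s : {perm V} | s @: A \in F]| * 'C(#|V|, #|A|) =
  #|[set B in F | #|B| == #|A|]| * (#|V|)`!.
Proof.
pose N (B : {set V}) := #|[set s : {perm V} | s @: A == B]|.
have NE (B : {set V}) : #|B| = #|A| -> N B = N A.
  move=> BA; have [t tA] := exists_perm_imset (esym BA).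
  rewrite /N -[RHS](card_imset _ (mulIg t)); apply: eq_card => s.
  rewrite inE; apply/eqP/imsetP => [sAB|[s']].
    exists (s * t^-1)%g; last by rewrite mulgKV.
    rewrite inE; apply/eqP/(imset_inj (@perm_inj _ t)).
    rewrite tA -sAB -imset_comp; apply: eq_imset => v /=.
    by rewrite permM permKV.
  rewrite inE => /eqP s'A ->; rewrite -[RHS]tA -[in RHS]s'A -imset_comp.
  by apply: eq_imset => v /=; rewrite permM.
have sumN (G : {set {set V}}) : 
    #|[set s : {perm V} | s @: A \in G]| = #|[set B in G | #|B| == #|A|]| * N A.
  rewrite -sum_nat_const -sum1_card.
  rewrite (partition_big (fun s : {perm V} => s @: A) (mem [set B in G | #|B| == #|A|])) /=.
    apply: eq_bigr => B; rewrite inE => /andP[BG /eqP BA]; rewrite -(NE _ BA).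
    rewrite sum1_card; apply: eq_card => s; rewrite !inE unfold_in /= inE.
    by case: eqVneq => [->|]; rewrite ?BG ?andbF.
  by move=> s; rewrite !inE => -> /=; rewrite card_imset //; exact: perm_inj.
have -> : (#|V|)`! = 'C(#|V|, #|A|) * N A.
  have -> : (#|V|)`! = #|[set s : {perm V} | s @: A \in [set: {set V}]]|.
    rewrite -cardsT -card_perm; apply: eq_card => s; rewrite !inE.
    by apply/subsetP => v; rewrite inE.
  rewrite sumN -card_draws; congr (_ * _).
  by apply: eq_card => B; rewrite !inE.
by rewrite sumN -!mulnA; congr (_ * _); rewrite mulnC.
Qed.

Lemma card_ffun_constant_on (V Z : finType) (A : {set V}) (b : Z) :
  #|[set f : {ffun V -> Z} | [forall x in A, f x == b]]| = #|Z| ^ (#|V| - #|A|).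
Proof.
pose F x := if x \in A then pred1 b else predT.
transitivity #|family F|.
  apply: eq_card => f; rewrite inE; apply/forall_inP/familyP => [fA x|fF x xA].
    by rewrite /F; case: ifP => // /fA.
  by have := fF x; rewrite /F xA.
rewrite card_family foldrE big_map big_enum /= (bigID (mem A)) /=.
rewrite (eq_bigr (fun=> 1)) ?[X in X * _]big1 ?mul1n //; last first.
  by move=> x xA; rewrite /F xA card1.
rewrite (eq_bigr (fun=> #|Z|)); last by move=> x /negPf xA; rewrite /F xA.
rewrite prod_nat_const; congr (_ ^ _).
transitivity #|~: A|; first by apply: eq_card => x; rewrite !inE.
by rewrite cardsCs setCK.
Qed.

(** First-moment method, with [W] as the probability space. *)
Lemma exists_ge_half (W T : finType) (P : W -> T -> bool) (E : {set T}) :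
  0 < #|W| -> (forall e, e \in E -> 2 * #|[set w | ~~ P w e]| <= #|W|) ->
  exists w, #|E| <= 2 * #|[set e in E | P w e]|.
Proof.
move=> W0 Ebad; apply/existsP; apply: contraT; rewrite negb_exists => /forallP Esmall.
have double_count : \sum_w #|[set e in E | P w e]| = \sum_(e in E) #|[set w | P w e]|.
  under eq_bigr do rewrite -sum1_card (eq_bigl _ _ (in_set _)) big_mkcondr /=.
  rewrite exchange_big /=; apply: eq_bigr => e _.
  by rewrite -big_mkcond -sum1_card /=; apply: eq_bigl => w; rewrite inE.
have Elt w : 2 * #|[set e in E | P w e]| < #|E| by rewrite ltnNge; exact: Esmall.
have : \sum_(w : W) 2 * #|[set e in E | P w e]| < \sum_(w : W) #|E|.
  have [w0 _] : exists w0 : W, w0 \in W by apply/card_gt0P.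
  rewrite (bigD1 w0) //= [ltnRHS](bigD1 w0) //= -addSn leq_add //.
  by apply: leq_sum => w _; exact: ltnW.
rewrite -big_distrr /= double_count sum_nat_const ltnNge => /negP[].
rewrite mulnC -sum_nat_const big_distrr /=; apply: leq_sum => e eE.
have := Ebad e eE; have <- : ~: [set w | P w e] = [set w | ~~ P w e].
  by apply/setP => w; rewrite !inE.
rewrite -(cardsC [set w | P w e]); lia.
Qed.

Lemma card_le_sum_cover (T I : finType) (P : pred I) (S : {set T}) (F : I -> {set T}) :
  (forall t, t \in S -> exists2 i, P i & t \in F i) ->
  #|S| <= \sum_(i | P i) #|F i|.
Proof.
move=> SF; under eq_bigr do rewrite -sum1_card big_mkcond /=.
rewrite exchange_big /= -sum1_card big_mkcond /=; apply: leq_sum => t _.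
case: ifP => // /SF[i Pi tF]; by rewrite (bigD1 i) //= tF.
Qed.

(** Union bound: some set of [J.+1] points of [e] is sent to a single bin. *)
Lemma card_big_bin (V Z : finType) (e : {set V}) (J : nat) :
  #|[set f : {ffun V -> Z} | [exists b, J < #|bin f b e|]]| * #|Z| ^ J.+1 <=
  #|Z| * 'C(#|e|, J.+1) * #|Z| ^ #|V|.
Proof.
have [Je|eJ] := leqP J.+1 #|e|; last first.
  rewrite [X in X * _](_ : _ = 0) //; apply: eq_card0 => f; rewrite inE.
  apply/existsP => -[b]; apply/negP; rewrite -leqNgt.
  rewrite ltnS in eJ; apply: leq_trans eJ; apply: subset_leq_card.
  by apply/subsetP => x; rewrite inE => /andP[].
pose S := [set A : {set V} | A \subset e & #|A| == J.+1].
have eV : #|e| <= #|V| by exact: max_card.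
pose G (p : Z * {set V}) := [set f : {ffun V -> Z} | [forall x in p.2, f x == p.1]].
apply: (@leq_trans ((\sum_(p in setX [set: Z] S) #|G p|) * #|Z| ^ J.+1)).
  rewrite leq_mul2r; apply/orP; right; apply: card_le_sum_cover => f.
  rewrite inE => /existsP[b Jb].
  have : 0 < #|[set A : {set V} | A \subset bin f b e & #|A| == J.+1]|.
    by rewrite cards_draws bin_gt0.
  case/card_gt0P => A; rewrite inE => /andP[Ab AJ]; exists (b, A).
    rewrite !inE /= AJ andbT (subset_trans Ab) //.
    by apply/subsetP => x; rewrite inE => /andP[].
  by rewrite inE; apply/forall_inP => x /(subsetP Ab); rewrite inE => /andP[].
rewrite (eq_bigr (fun=> #|Z| ^ (#|V| - J.+1))); last first.
  by case=> b A; rewrite !inE /= => /andP[_ /eqP AJ]; rewrite card_ffun_constant_on AJ.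
by rewrite sum_nat_const cardsX cardsT cards_draws -mulnA -expnD subnK // (leq_trans Je).
Qed.

(** Independent random copies of [F] miss [A] with probability at most
    [(1 - 1 / K) ^ L]; the inequality is multiplied out to stay in [nat]. *)
Lemma card_uncovered (V : finType) (F : {set {set V}}) (A : {set V}) (K L : nat) :
  'C(#|V|, #|A|) <= K * #|[set B in F | #|B| == #|A|]| ->
  #|[set s : {ffun 'I_L -> {perm V}} | [forall i, s i @: A \notin F]]| * K ^ L <=
  K.-1 ^ L * (#|V|)`! ^ L.
Proof.
move=> KA; pose P := [set s : {perm V} | s @: A \notin F].
have -> : #|[set s : {ffun 'I_L -> {perm V}} | [forall i, s i @: A \notin F]]| = #|P| ^ L.
  rewrite -[in RHS](card_ord L) -card_ffun_on; apply: eq_card => s; rewrite inE.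
  by apply/forallP/ffun_onP => sP i; have := sP i; rewrite inE.
rewrite -!expnMn; case: L => // L; rewrite leq_exp2r //.
pose Q := [set s : {perm V} | s @: A \in F].
have PQ : #|Q| + #|P| = (#|V|)`!.
  have -> : P = ~: Q by apply/setP => s; rewrite !inE.
  rewrite cardsC; transitivity #|perm_on [set: V]|; last by rewrite card_perm cardsT.
  by apply: eq_card => s; rewrite [RHS]inE; apply/esym/subsetP => v; rewrite inE.
have C0 : 0 < 'C(#|V|, #|A|) by rewrite bin_gt0 max_card.
have QK : (#|V|)`! <= K * #|Q|.
  rewrite -(leq_pmul2r C0) -mulnA card_perm_imset_in mulnA mulnC leq_mul2r KA.
  by rewrite orbT.
rewrite -PQ in QK *; case: K QK {KA} => [|K]; first by rewrite mul0n muln0.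
by rewrite mulSn leq_add2l /= mulnS mulnDr [#|P| * K]mulnC leq_add2r.
Qed.

(** * The recursion *)

(** The probability space consists of a hash function of the vertices into
    [m.+1] bins and of [L.+1] permutations, the random copies of [F].  The two
    numerical hypotheses say that each of the events that an edge overfills some
    bin, and that its trace on some bin lies in no copy, has probability at most
    [1 / 4].  So some choice makes half of all [r]-sets coloured, and the best of
    the [m.+1 * L.+1] values of [hash] keeps its share of them. *)
Lemma turan_number_recursion (n r m J K L : nat) (F : {set {set 'I_n}}) :
  1 < r -> 0 < K -> triple_free F ->
  (forall j, j <= J -> 'C(n, j) <= K * #|[set A in F | #|A| == j]|) ->
  4 * m.+1 * 'C(r, J.+1) <= m.+1 ^ J.+1 ->
  4 * m.+1 * K.-1 ^ L.+1 <= K ^ L.+1 ->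
  'C(n, r) <= 2 * (m.+1 * L.+1) * turan_number r n (Hgraph r 3).
Proof.
move=> r1 K0 F_free FK few_big few_bad.
pose W := ({ffun 'I_n -> 'I_m.+1} * {ffun 'I_L.+1 -> {perm 'I_n}})%type.
pose col (s : {ffun 'I_L.+1 -> {perm 'I_n}}) (A : {set 'I_n}) :=
  [pick i | s i @: A \in F].
pose E := [set e : {set 'I_n} | #|e| == r].
pose good (w : W) e := coloured w.1 (col w.2) e.
have card_perms : #|{ffun 'I_L.+1 -> {perm 'I_n}}| = n`! ^ L.+1.
  by rewrite card_ffun card_Sn card_ord.
have card_hashes : #|{ffun 'I_n -> 'I_m.+1}| = m.+1 ^ n.
  by rewrite card_ffun !card_ord.
have cardW : #|{: W}| = m.+1 ^ n * n`! ^ L.+1 by rewrite card_prod card_hashes card_perms.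
have [w Ew] : exists w, #|E| <= 2 * #|[set e in E | good w e]|.
  apply: exists_ge_half; first by rewrite cardW muln_gt0 !expn_gt0 fact_gt0.
  move=> e; rewrite inE => /eqP er; rewrite cardW.
  pose B := [set f : {ffun 'I_n -> 'I_m.+1} | [exists b, J < #|bin f b e|]].
  pose Z := ({ffun 'I_n -> 'I_m.+1} * 'I_m.+1)%type.
  pose S (p : Z) :=
    [set s : {ffun 'I_L.+1 -> {perm 'I_n}} | [forall i, s i @: bin p.1 p.2 e \notin F]].
  (* Bad choices: some bin is overfull, whatever the permutations are, or no bin
     is overfull and the permutations fail to cover some trace. *)
  have cover : #|[set w : W | ~~ good w e]| <=
      #|B| * n`! ^ L.+1 + \sum_(p : Z | #|bin p.1 p.2 e| <= J) #|setX [set p.1] (S p)|.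
    have /subset_leq_card/leq_trans -> // : [set w : W | ~~ good w e] \subset
        setX B setT :|: [set w : W | ~~ good w e & w.1 \notin B].
      by apply/subsetP => -[f s]; rewrite !inE /= => ->; rewrite andbT orbN.
    rewrite (leq_trans (leq_card_setU _ _)) // cardsX cardsT card_perms leq_add2l.
    apply: card_le_sum_cover => -[f s]; rewrite !inE /= => /andP[].
    rewrite /good /coloured negb_forall => /existsP[b] /=.
    rewrite /col; case: pickP => // no_i _ /existsPn/(_ b); rewrite -leqNgt => bJ.
    exists (f, b) => //; rewrite !inE eqxx /=; apply/forallP => i.
    by rewrite no_i.
  have small_B : 4 * #|B| <= m.+1 ^ n.
    rewrite -(@leq_pmul2r (m.+1 ^ J.+1)) ?expn_gt0 // -mulnA.
    have := card_big_bin 'I_m.+1 e J; rewrite !card_ord er => BM.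
    rewrite (leq_trans (leq_mul (leqnn 4) BM)) // !mulnA mulnC leq_mul2l.
    by rewrite few_big orbT.
  have small_S : 4 * (\sum_(p : Z | #|bin p.1 p.2 e| <= J) #|setX [set p.1] (S p)|) <=
      m.+1 ^ n * n`! ^ L.+1.
    rewrite -(@leq_pmul2r (K ^ L.+1)) ?expn_gt0 ?K0 // -mulnA big_distrl /=.
    apply: (@leq_trans (4 * (m.+1 ^ n * m.+1 * (K.-1 ^ L.+1 * n`! ^ L.+1)))).
      rewrite leq_mul2l /= -{1}card_hashes -[m.+1 in X in _ * X * _](card_ord m.+1).
      rewrite -card_prod -sum_nat_const [leqLHS]big_mkcond /=.
      apply: leq_sum => p _; case: ifP => // pJ.
      rewrite cardsX cards1 mul1n.
      by have := @card_uncovered _ F (bin p.1 p.2 e) K L.+1; rewrite card_ord; apply; exact: FK.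
    rewrite [leqLHS](_ : _ = m.+1 ^ n * n`! ^ L.+1 * (4 * m.+1 * K.-1 ^ L.+1)); last by ring.
    by rewrite leq_mul2l few_bad orbT.
  rewrite (leq_trans (leq_mul (leqnn 2) cover)) // -(@leq_pmul2l 2) //.
  have := leq_mul small_B (leqnn (n`! ^ L.+1)); move: small_S; rewrite -/B.
  set X := m.+1 ^ n * _; set b := \sum_(p : Z | _) _; rewrite -mulnA; set a := _ * _.
  lia.
have [u Eu] := exists_large_fiber (hash w.1 (col w.2)) 0%R [set e in E | good w e].
set G := [set e in _ | hash _ _ e == u] in Eu.
have Gr : uniform r G by apply/forall_inP => e; rewrite /G !inE => /andP[/andP[]].
have G_free : triple_free G.
  apply: (@triple_freeS _ _ [set e | coloured w.1 (col w.2) e & hash w.1 (col w.2) e == u]).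
    by apply/subsetP => e; rewrite /G !inE /good => /andP[/andP[_ ->]].
  apply: triple_free_hash => i.
  apply: (@triple_freeS _ _ [set A : {set 'I_n} | w.2 i @: A \in F]).
    by apply/subsetP => A; rewrite !inE /col; case: pickP => // j jA /eqP[<-].
  apply: triple_free_preimset => //; exact: perm_inj.
have := turan_number_triple_free r1 Gr G_free.
rewrite card_prod !card_ord in Eu => Gt.
rewrite -[n in 'C(n, r)]card_ord -card_draws (leq_trans Ew) // -mulnA leq_mul2l /=.
by rewrite (leq_trans Eu) // leq_mul2l Gt orbT.
Qed.

(** * The iterated bound *)

Lemma Hgraph3_neq0 r : Hgraph r 3 != set0.
Proof. by apply/set0Pn; exists [set~ ord0]; apply/imsetP; exists ord0; rewrite ?inE. Qed.

(** Extremal graphs of all sizes [2 <= j <= J] form together one triple-free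
    family, because the sets [T :\ x] for [x] in [T] have equal sizes.  All sets
    of size at most one can be added: the [T] concerned have at most two points. *)
Lemma exists_local_family (n J K : nat) :
  0 < K ->
  (forall j, 1 < j <= J -> 'C(n, j) <= K * turan_number j n (Hgraph j 3)) ->
  exists2 F : {set {set 'I_n}}, triple_free F &
    forall j, j <= J -> 'C(n, j) <= K * #|[set A in F | #|A| == j]|.
Proof.
move=> K0 exK.
have /choice[G GP] : forall j, exists G : {set {set 'I_n}},
    [/\ uniform j G, triple_free G & turan_number j n (Hgraph j 3) = #|G|].
  move=> j; have [G /andP[Gj Gfree] GE] := turan_numberP j n (Hgraph3_neq0 j).
  by exists G; split => //; exact: copy_free_triple_free Gfree.
exists [set A : {set 'I_n} | (#|A| <= 1) || (A \in G #|A|)].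
  move=> T x y z xT yT zT xy xz yz; rewrite !inE.
  have T2 : 2 < #|T|.
    apply/card_gt2P; exists x, y, z; split; split=> //; by rewrite eq_sym.
  have cardD w : w \in T -> #|T :\ w| = #|T|.-1 by move=> wT; rewrite (cardsD1 w T) wT.
  rewrite !cardD // leqNgt -ltnS prednK ?T2 /=; last exact: ltnW (ltnW T2).
  have [_ G_free _] := GP #|T|.-1; exact: G_free.
move=> j jJ; have [j1|j1] := leqP j 1.
  rewrite -[n in 'C(n, j)]card_ord -card_draws.
  have -> : [set A : {set 'I_n} | #|A| == j] =
      [set A in [set A : {set 'I_n} | (#|A| <= 1) || (A \in G #|A|)] | #|A| == j].
    by apply/setP => A; rewrite !inE; case: eqVneq => [->|]; rewrite ?j1 ?andbF.
  exact: leq_pmull.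
rewrite (leq_trans (exK j _)) ?j1 // leq_mul2l; have [Gj _ ->] := GP j.
rewrite subset_leq_card ?orbT //; apply/subsetP => A AG.
by rewrite !inE (eqP (forall_inP Gj A AG)) AG eqxx orbT.
Qed.

Lemma leq_bin_exp r k : 'C(r, k) <= r ^ k.
Proof.
apply: (@leq_trans (r ^_ k)); first by rewrite -bin_ffact leq_pmulr ?fact_gt0.
by elim: k => // k IHk; rewrite ffactnSr expnSr leq_mul ?leq_subr.
Qed.

(** [(1 - 1 / K) ^ K <= 1 / 2], from Bernoulli's inequality for
    [(1 + 1 / a) ^ k] with [a = K.-1]. *)
Lemma double_pred_exp K : 0 < K -> 2 * K.-1 ^ K <= K ^ K.
Proof.
case: K => // a _ /=.
have bernoulli k : (a + k) * a ^ k <= a * a.+1 ^ k.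
  elim: k => [|k IHk]; first by rewrite addn0.
  rewrite !expnS; move: IHk; set x := a ^ k; set y := a.+1 ^ k; nia.
case: a bernoulli => [|a] // bernoulli.
rewrite -(@leq_pmul2l a.+1) // (leq_trans _ (bernoulli a.+2)) //.
by rewrite mulnA leq_mul2r; apply/orP; right; lia.
Qed.

(** With [2 * r ^ 2] bins, an [r]-set is hashed injectively with probability at
    least [3 / 4], and then the traces on the bins need no further care. *)
Lemma quadratic_turan_bound (n r : nat) : 1 < r ->
  'C(n, r) <= 4 * r ^ 2 * turan_number r n (Hgraph r 3).
Proof.
move=> r1; have [F F_free FK] : exists2 F : {set {set 'I_n}}, triple_free F &
    forall j, j <= 1 -> 'C(n, j) <= 1 * #|[set A in F | #|A| == j]|.
  by apply: exists_local_family => // j /andP[j1]; rewrite leqNgt j1.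
have r2 : 0 < 2 * r ^ 2 by rewrite muln_gt0 expn_gt0 (ltnW r1).
have -> : 4 * r ^ 2 = 2 * ((2 * r ^ 2).-1.+1 * 1) by rewrite prednK //; lia.
apply: turan_number_recursion F_free FK _ _ => //; rewrite prednK //; last by rewrite muln0.
have := mul_bin_left r 1; rewrite bin1; nia.
Qed.

(** With high probability, no bin receives more points of a given [r]-set when
    there are [2 * r] bins.  The summand [3] provides [8 * r <= 2 ^ bin_cap r],
    which covers both union bounds in the recursion. *)
Definition bin_cap (r : nat) : nat := (up_log 2 r + 3)%N.

(** [2 * r] bins and [bin_cap r * K] copies: each group of [K] copies halves the
    probability of missing a given trace. *)
Lemma turan_bound_step (n r K : nat) : 1 < r -> 0 < K ->
  (forall j, 1 < j <= bin_cap r ->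
    'C(n, j) <= K * turan_number j n (Hgraph j 3)) ->
  'C(n, r) <= 4 * r * (bin_cap r * K) * turan_number r n (Hgraph r 3).
Proof.
move=> r1 K0 /(exists_local_family K0)[F F_free FK].
have J0 : 0 < bin_cap r by rewrite /bin_cap addn3.
have rJ : 8 * r <= 2 ^ bin_cap r.
  by rewrite /bin_cap expnD mulnC leq_mul2r up_logP.
have r0 : 0 < 2 * r by rewrite muln_gt0 (ltnW r1).
have L0 : 0 < bin_cap r * K by rewrite muln_gt0 J0.
have -> : 4 * r * (bin_cap r * K) = 2 * ((2 * r).-1.+1 * (bin_cap r * K).-1.+1).
  by rewrite !prednK //; ring.
apply: turan_number_recursion F_free FK _ _ => //; rewrite !prednK //.
  rewrite expnMn leq_mul ?leq_bin_exp // expnS; move: rJ.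
  by set p := 2 ^ _; lia.
rewrite [bin_cap r * K]mulnC !expnM.
have := double_pred_exp K0; rewrite -(leq_exp2r _ _ J0) expnMn.
by apply: leq_trans; rewrite leq_mul2r mulnA rJ orbT.
Qed.

(** The quadratic input costs [J ^ 3] in the first round.  The second round needs
    the first one only for sizes at most [J], where the cost is [J] times an
    iterated logarithm; this leaves [J ^ 2]. *)
Lemma turan_bound (n r : nat) : 1 < r ->
  'C(n, r) <= 64 * r * (bin_cap r ^ 2 * bin_cap (bin_cap r) ^ 3) *
    turan_number r n (Hgraph r 3).
Proof.
have bin_cap_mono : {homo bin_cap : i j / i <= j}.
  by move=> i j ij; rewrite /bin_cap leq_add2r leq_up_log.
have cap_gt0 i : 0 < bin_cap i by rewrite /bin_cap addn3.
have cubic i : 1 < i -> 'C(n, i) <= 16 * i * bin_cap i ^ 3 * turan_number i n (Hgraph i 3).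
  move=> i1.
  have -> : 16 * i * bin_cap i ^ 3 = 4 * i * (bin_cap i * (4 * bin_cap i ^ 2)) by ring.
  apply: turan_bound_step => // [|j /andP[j1 ji]]; first by rewrite muln_gt0 expn_gt0 cap_gt0.
  rewrite (leq_trans (quadratic_turan_bound n j1)) // leq_mul2r leq_mul2l leq_exp2r //.
  by rewrite ji !orbT.
move=> r1; set J := bin_cap r.
have -> : 64 * r * (J ^ 2 * bin_cap J ^ 3) = 4 * r * (J * (16 * J * bin_cap J ^ 3)) by ring.
apply: turan_bound_step => // [|j /andP[j1 jJ]]; first by rewrite !muln_gt0 ?expn_gt0 !cap_gt0.
rewrite (leq_trans (cubic j j1)) // leq_mul2r; apply/orP; right.
by apply: leq_mul; rewrite ?leq_mul2l ?jJ // leq_exp2r // bin_cap_mono.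
Qed.

(** * Asymptotics *)

Local Open Scope classical_set_scope.
Local Open Scope ring_scope.

Lemma bin_cap_le_ln (R : realType) (r : nat) : (1 < r)%N ->
  (bin_cap r)%:R <= 5 / ln 2 * ln r%:R :> R.
Proof.
move=> r1; have ln2 : 0 < ln 2 :> R by rewrite ln_gt0 // ltr1n.
have r0 : (0 : R) < r%:R by rewrite ltr0n ltnW.
have ln2r : ln 2 <= ln r%:R :> R by rewrite ler_ln ?posrE // ler_nat.
have : (up_log 2 r).-1%:R * ln 2 <= ln r%:R :> R.
  rewrite mulrC mulr_natr -lnXn // ler_ln ?posrE ?exprn_gt0 //.
  by rewrite -natrX ler_nat ltnW // up_log_gtn.
have -> : (bin_cap r)%:R = (up_log 2 r).-1%:R + 4 :> R.
  have : (0 < up_log 2 r)%N by rewrite up_log_gt0 r1.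
  by rewrite /bin_cap; case: (up_log 2 r) => // k _; rewrite -natrD addSnnS.
move=> kr; rewrite mulrAC ler_pdivlMr // mulrDl; lra.
Qed.

Lemma ln_le_powR (R : realType) (x d : R) : 0 < x -> 0 < d ->
  ln x <= d^-1 * x `^ d.
Proof.
move=> x0 d0; rewrite ler_pdivlMl // -ln_powR ltW // ln_sublinear //.
exact: powR_gt0.
Qed.

(** The iterated logarithm in [turan_bound] enters only as a cube, so
    [log J <= J ^ (eps / 3) * 3 / eps], with [J = bin_cap r], turns it into the factor [J ^ eps]. *)
Lemma turan_density_lower (R : realType) (eps : R) : 0 < eps ->
  exists c : R, 0 < c /\ forall r : nat, (1 < r)%N ->
    c / (r%:R * (ln r%:R) `^ (2 + eps)) <= turan_density R r (Hgraph r 3).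
Proof.
move=> eps0; pose A : R := 5 / ln 2; pose d := eps / 3.
have ln2 : 0 < ln 2 :> R by rewrite ln_gt0 // ltr1n.
have A0 : 0 < A by rewrite divr_gt0.
have d0 : 0 < d by rewrite divr_gt0.
pose B := (A / d) ^+ 3 * A `^ (2 + eps).
have B0 : 0 < B by rewrite mulr_gt0 ?exprn_gt0 ?divr_gt0 ?powR_gt0.
have B64 : 0 < 64 * B by rewrite mulr_gt0.
exists (64 * B)^-1; split; first by rewrite invr_gt0.
move=> r r1; set J := bin_cap r.
have J1 : (1 < J)%N by rewrite /J /bin_cap addn3.
have J0 : (0 : R) < J%:R by rewrite ltr0n ltnW.
have r0 : (0 : R) < r%:R by rewrite ltr0n ltnW.
have lnr0 : 0 < ln r%:R :> R by rewrite ln_gt0 // ltr1n.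
have capJ : (bin_cap J)%:R <= A / d * J%:R `^ d.
  apply: le_trans (bin_cap_le_ln R J1) _; rewrite -/A -[leRHS]mulrA ler_pM2l //.
  exact: ln_le_powR.
have caps : (J ^ 2 * bin_cap J ^ 3)%:R <= B * (ln r%:R) `^ (2 + eps).
  apply: (@le_trans _ _ ((A / d) ^+ 3 * J%:R `^ (2 + eps))).
    have -> : J%:R `^ (2 + eps) = J%:R ^+ 2 * (J%:R `^ d) ^+ 3.
      rewrite -[X in _ * X]powR_mulrn ?powR_ge0 // -powRrM /d mulfVK //.
      by rewrite -powR_mulrn ?ltW // -powRD // (gt_eqF J0) implybT.
    rewrite mulrCA -exprMn natrM !natrX ler_pM2l ?exprn_gt0 //.
    by rewrite lerXn2r // nnegrE // mulr_ge0 ?powR_ge0 // ltW // divr_gt0.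
  rewrite /B -mulrA ler_pM2l ?exprn_gt0 ?divr_gt0 // -powRM ?(ltW A0) ?(ltW lnr0) //.
  apply: ge0_ler_powR; rewrite ?nnegrE ?ler0n ?(mulr_ge0 (ltW A0) (ltW lnr0)) //.
    by rewrite addr_ge0 // ltW.
  exact: bin_cap_le_ln.
apply: turan_density_ge; first exact: Hgraph3_neq0.
move=> n rn; rewrite /turan_ratio.
have C0 : (0 : R) < 'C(n, r)%:R by rewrite ltr0n bin_gt0.
have X0 : 0 < r%:R * (ln r%:R) `^ (2 + eps) by rewrite mulr_gt0 ?powR_gt0.
rewrite -invfM ler_pdivlMr // mulrC ler_pdivrMr ?(mulr_gt0 B64 X0) //.
have := turan_bound n r1; rewrite -(ler_nat R) => /le_trans -> //.
rewrite natrM mulrC ler_wpM2l // -mulnA 2!natrM -mulrA ler_pM2l //.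
by rewrite [leRHS]mulrCA ler_pM2l.
Qed.

Lemma turan_density_upper (R : realType) (r : nat) : (0 < r)%N ->
  turan_density R r (Hgraph r 3) <= 2 / r%:R.
Proof.
move=> r0; apply: le_trans (turan_density_le R (Hgraph3_neq0 r) (leqnSn r)) _.
rewrite /turan_ratio binSn.
apply: ler_pM; rewrite ?invr_ge0 ?ler_nat ?turan_number_r1 //.
by rewrite lef_pV2 ?posrE ?ltr0n // ler_nat.
Qed.

Lemma near_ln_natr_ge (R : realType) (A : R) : \forall r \near \oo, A <= ln r%:R.
Proof.
exists (Num.truncn (expR A)).+1 => // r /= Ar.
rewrite -[A]expRK ler_ln ?posrE ?expR_gt0 ?ltr0n //; last exact: leq_trans Ar.
by rewrite (le_trans (ltW (truncnS_gt _))) // ler_nat.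
Qed.

Theorem theorem1p2 (R : realType) :
  (forall eps : R, 0 < eps ->
     exists c : R, 0 < c /\
       \forall r \near \oo,
         c / (r%:R * (ln r%:R) `^ (2 + eps)) <= turan_density R r (Hgraph r 3))
  /\
  (fun r : nat => ln (turan_density R r (Hgraph r 3)) / ln r%:R) @ \oo
     --> (-1 : R).
Proof.
split=> [eps /turan_density_lower[c [c0 cP]]|].
  by exists c; split=> //; exists 2%N => // r /=; exact: cP.
(* Any exponent of the logarithm gives the limit, so take [eps = 1]; [a] is the
   slope in [ln x <= a * x - ln a] for [x = ln r], chosen with [3 * a = e / 2]. *)
have [c [c0 cP]] := turan_density_lower (@ltr01 R).
apply/cvgrPdist_le => e e0; pose a := e / 6.
have a0 : 0 < a by rewrite divr_gt0.
near=> r.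
have r1 : (1 < r)%N by near: r; exists 2%N.
have r0 : 0 < r%:R :> R by rewrite ltr0n ltnW.
have x_lower : - (ln c + 3 * ln a) / (e / 2) <= ln r%:R :> R by near: r; exact: near_ln_natr_ge.
have x_upper : ln 2 / e <= ln r%:R :> R by near: r; exact: near_ln_natr_ge.
set x : R := ln r%:R in x_lower x_upper *.
have x0 : 0 < x by rewrite ln_gt0 // ltr1n.
have D_lower := cP r r1; have D_upper := turan_density_upper R (ltnW r1).
rewrite -/x in D_lower; set D := turan_density _ _ _ in D_lower D_upper *.
have lower0 : 0 < c / (r%:R * x `^ (2 + 1)) by rewrite divr_gt0 ?mulr_gt0 ?powR_gt0.
have D0 : 0 < D by exact: lt_le_trans D_lower.
have lnD_upper : ln D <= ln 2 - x.
  by rewrite -ln_div ?posrE // ler_ln ?posrE ?divr_gt0.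
have lnD_lower : ln c - (x + 3 * ln x) <= ln D.
  have -> : 3 = 2 + 1 :> R by rewrite natr1.
  by rewrite -ln_powR -lnM ?posrE ?powR_gt0 // -ln_div ?posrE ?mulr_gt0 ?powR_gt0 // ler_ln ?posrE.
have lnx : ln x <= a * x - ln a.
  by rewrite lerBrDl -lnM ?posrE // ltW // ln_sublinear // mulr_gt0.
rewrite ler_pdivrMr ?divr_gt0 // in x_lower; rewrite ler_pdivrMr // in x_upper.
have -> : -1 - ln D / x = - (x + ln D) / x by field; rewrite gt_eqF.
rewrite normrM normrN normfV (gtr0_norm x0) ler_pdivrMr // ler_norml.
rewrite /a in lnx x_lower *; apply/andP; split; nra.
Unshelve. all: by end_near. Qed.
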